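(* Assume $\sum_{\ell=1}^{N_{\mathrm{HVAC}}}P_\ell>P_{\mathrm{total},t}^{(N)}$. Then the adjustable distributionally robust chance constraint $$\inf_{f\in\mathcal D_t^2}\mathbb P_f\Big(\sum_{\ell=1}^{N_{\mathrm{HVAC}}}P_\ell u_{t,\ell}-\sum_{i=1}^{N_{\mathrm{PV}}}\widetilde P_{\mathrm{PV},t,i}\ge0\Big)\ge1-\alpha_t$$ on the decisions $u_t\in\{0,1\}^{N_{\mathrm{HVAC}}}$ and $\alpha_t$ with $0\le\alpha_t\le1$ is feasible (satisfied by $(u_t,\alpha_t)$) if and only if the following mixed integer linear constraints with auxiliary variables $\Delta_{jk}\in\{0,1\}$, $\varepsilon_{jk}\in\mathbb R$, $\tau_{\ell jk}\in\mathbb R$, $o_{\ell jk}\in\mathbb R$ are feasible: $$\sum_{j=1}^N\sum_{k=j-1}^{N-1}\Big[-\frac1N\sum_{i=j}^k\big(P_{\mathrm{total},t}^{(k+1)}-P_{\mathrm{total},t}^{(i)}\big)\Delta_{jk}-\sum_{\ell=1}^{N_{\mathrm{HVAC}}}P_\ell\Big(o_{\ell jk}-\frac{j-1}N\tau_{\ell jk}\Big)+P_{\mathrm{total},t}^{(k+1)}\Big(\varepsilon_{jk}-\frac{j-1}N\Delta_{jk}\Big)\Big]\le-\delta_t,$$ $$\sum_{j=1}^N\sum_{k=j-1}^{N-1}\Delta_{jk}=1,$$ $$\sum_{j=1}^N\sum_{k=j-1}^{N-1}k\Delta_{jk}\le\alpha_tN\le\sum_{j=1}^N\sum_{k=j-1}^{N-1}(k+1)\Delta_{jk},$$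 $$\sum_{j=1}^N\sum_{k=j-1}^{N-1}P_{\mathrm{total},t}^{(j)}\Delta_{jk}\le\sum_{\ell=1}^{N_{\mathrm{HVAC}}}P_\ell u_{t,\ell}\le\sum_{j=1}^N\sum_{k=j-1}^{N-1}P_{\mathrm{total},t}^{(j-1)}\Delta_{jk},$$ and, for all $0\le j-1\le k\le N-1$ and $1\le\ell\le N_{\mathrm{HVAC}}$, $$\varepsilon_{jk}\le\Delta_{jk},\quad \varepsilon_{jk}\le\alpha_t,\quad \varepsilon_{jk}\ge\alpha_t+\Delta_{jk}-1,\quad \varepsilon_{jk}\ge0,$$ $$o_{\ell jk}\le\varepsilon_{jk},\quad o_{\ell jk}\le u_{t,\ell},\quad o_{\ell jk}\ge\varepsilon_{jk}+u_{t,\ell}-1,\quad o_{\ell jk}\ge0,$$ $$\tau_{\ell jk}\le\Delta_{jk},\quad \tau_{\ell jk}\le u_{t,\ell},\quad \tau_{\ell jk}\ge\Delta_{jk}+u_{t,\ell}-1,\quad \tau_{\ell jk}\ge0,$$ $$\Delta_{jk}\in\{0,1\}.$$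
   Context: $N_{\mathrm{HVAC}},N_{\mathrm{PV}},N\ge1$ are integers; $t$ is a fixed period; $P_\ell$ is the energy consumption of unit $\ell$ during one period when it is ON; $u_{t,\ell}\in\{0,1\}$ is the ON/OFF decision for unit $\ell$ and $u_t=(u_{t,\ell})_\ell$; the risk level $\alpha_t$ is a decision variable; $\delta_t>0$ is a given radius. $\widetilde P_{\mathrm{PV},t}$ is a random vector in $\mathbb R^{N_{\mathrm{PV}}}$ with distribution $f$, and $\mathbb P_f$ is probability under $f$. Samples $P^1_{\mathrm{PV},t},\ldots,P^N_{\mathrm{PV},t}\in\mathbb R^{N_{\mathrm{PV}}}$ are given, with empirical distribution $\mathbb P^N$ giving mass $1/N$ to each sample. The Wasserstein ambiguity set is $\mathcal D_t^2=\{f:\ \mathbb P_f(\widetilde P_{\mathrm{PV},t}\in\mathbb R^{N_{\mathrm{PV}}})=1,\ W(\mathbb P_f,\mathbb P^N)\le\delta_t\}$, where $W(\mathbb P_1,\mathbb P_2)=\inf_{\mathbb Q}\int\|\xi^1-\xi^2\|\,\mathbb Q(d\xi^1,d\xi^2)$, the infimum being over all joint distributions $\mathbb Q$ on $\mathbb R^{N_{\mathrm{PV}}}\times\mathbb R^{N_{\mathrm{PV}}}$ with marginals $\mathbb P_1,\mathbb P_2$, and $\|\cdot\|$ is a norm on $\mathbb R^{N_{\mathrm{PV}}}$ (not further specified). Put $P^n_{\mathrm{total},t}=\mathbf 1^\top P^n_{\mathrm{PV},t}$, where $\mathbf 1$ is the all-ones vector, let $P_{\mathrm{total},t}^{(1)}\ge\cdots\ge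 P_{\mathrm{total},t}^{(N)}$ be these values sorted in non-increasing order, and let $P_{\mathrm{total},t}^{(0)}=\sum_{\ell=1}^{N_{\mathrm{HVAC}}}P_\ell$. The indices $j,k$ are integers with $0\le j-1\le k\le N-1$; empty sums are $0$.
   Formalization: The norm is assumed to give the all-ones vector dual norm 1 (e.g. the l1 norm); the chance constraint implies the MILP only for α_t < 1, since at α_t = 1 it is vacuous while the MILP may be infeasible; P_ℓ ≥ 0 is made explicit. *)

(* Defs.v *)
From HB Require Import structures.
From mathcomp Require Import all_boot all_order all_algebra.
From mathcomp Require Import all_classical all_reals all_analysis.

Set Implicit Arguments.
Unset Strict Implicit.
Unset Printing Implicit Defensive.
Import Order.TTheory GRing.Theory Num.Theory.
Import numFieldNormedType.Exports.
Local Open Scope classical_set_scope.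
Local Open Scope ring_scope.

(* R^d with its Borel sigma-algebra, generated by the open sets. *)
Definition borel_rV (R : realType) (d : nat) :=
  g_sigma_algebraType (@open 'rV[R]_d).

Definition total_output (R : realType) (d : nat) (x : 'rV[R]_d) : R :=
  \sum_(i < d) x ord0 i.

Definition is_norm (R : realType) (d : nat) (nrm : 'rV[R]_d -> R) : Prop :=
  [/\ forall x y, nrm (x + y) <= nrm x + nrm y,
      forall a x, nrm (a *: x) = `|a| * nrm x
    & forall x, nrm x = 0 -> x = 0].

Definition dual_norm (R : realType) (d : nat) (nrm : 'rV[R]_d -> R)
    (c : 'rV[R]_d) : R :=
  sup [set \sum_(i < d) c ord0 i * x ord0 i | x in [set x | nrm x <= 1]].

Section wasserstein.
Context (R : realType) (d : nat).
Local Notation T := (borel_rV R d).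

(* The marginal laws are only compared on Borel sets. *)
Definition couplings (mu nu : set T -> \bar R) : set (probability (T * T)%type R) :=
  [set Q | (forall A, measurable A -> Q (fst @^-1` A) = mu A) /\
           (forall A, measurable A -> Q (snd @^-1` A) = nu A)].

Definition wasserstein (nrm : 'rV[R]_d -> R) (mu nu : set T -> \bar R) : \bar R :=
  ereal_inf [set (\int[Q]_z (nrm ((z.1 : 'rV[R]_d) - (z.2 : 'rV[R]_d)))%:E)%E
            | Q in couplings mu nu].

Definition empirical (N : nat) (xi : 'I_N -> 'rV[R]_d) (A : set T) : \bar R :=
  ((N%:R^-1)%:E * \sum_(n < N) \d_(xi n : T) A)%E.

Definition ambiguity_set (nrm : 'rV[R]_d -> R) (N : nat) (xi : 'I_N -> 'rV[R]_d)
    (delta : R) : set (probability T R) :=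
  [set f | (wasserstein nrm f (empirical xi) <= delta%:E)%E].

End wasserstein.

Definition load (R : realType) (H : nat) (P : 'I_H -> R) (u : 'I_H -> bool) : R :=
  \sum_(l < H) P l * (u l)%:R.

Definition dr_chance_constraint (R : realType) (H d N : nat) (P : 'I_H -> R)
    (nrm : 'rV[R]_d -> R) (xi : 'I_N -> 'rV[R]_d) (delta : R)
    (u : 'I_H -> bool) (alpha : R) : Prop :=
  ((1 - alpha)%:E <=
     ereal_inf [set f [set x : borel_rV R d | (0 <= load P u - total_output x)%R]
               | f in ambiguity_set nrm xi delta])%E.

(* [sorted_total P xi i] is the i-th largest sample total for 1 <= i <= N, and
   the total load for i = 0. *)
Definition sorted_total (R : realType) (H d N : nat) (P : 'I_H -> R)
    (xi : 'I_N -> 'rV[R]_d) (i : nat) : R :=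
  if i is i'.+1
  then nth 0 (sort (fun x y : R => y <= x) [seq total_output (xi n) | n <- enum 'I_N]) i'
  else \sum_(l < H) P l.

(* Auxiliary variables are indexed by all naturals j, k, but only the entries
   with 0 <= j - 1 <= k <= N - 1 occur in the constraints. *)
Record milp (R : realType) (H d N : nat) (P : 'I_H -> R)
    (xi : 'I_N -> 'rV[R]_d) (delta : R) (u : 'I_H -> bool) (alpha : R)
    (Delta : nat -> nat -> bool) (eps : nat -> nat -> R)
    (tau o : 'I_H -> nat -> nat -> R) : Prop := Milp {
  milp_wasserstein :
    \sum_(1 <= j < N.+1) \sum_(j.-1 <= k < N)
      (- (N%:R^-1 * \sum_(j <= i < k.+1)
             (sorted_total P xi k.+1 - sorted_total P xi i) * (Delta j k)%:R)
       - \sum_(l < H) P l * (o l j k - j.-1%:R / N%:R * tau l j k)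
       + sorted_total P xi k.+1 * (eps j k - j.-1%:R / N%:R * (Delta j k)%:R))
    <= - delta;
  milp_select :
    \sum_(1 <= j < N.+1) \sum_(j.-1 <= k < N) (Delta j k)%:R = 1 :> R;
  milp_risk :
    \sum_(1 <= j < N.+1) \sum_(j.-1 <= k < N) k%:R * (Delta j k)%:R
      <= alpha * N%:R
      <= \sum_(1 <= j < N.+1) \sum_(j.-1 <= k < N) k.+1%:R * (Delta j k)%:R;
  milp_load :
    \sum_(1 <= j < N.+1) \sum_(j.-1 <= k < N)
        sorted_total P xi j * (Delta j k)%:R
      <= load P u
      <= \sum_(1 <= j < N.+1) \sum_(j.-1 <= k < N)
           sorted_total P xi j.-1 * (Delta j k)%:R;
  milp_eps : forall j k : nat, (0 < j <= k.+1)%N -> (k < N)%N ->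
    [/\ eps j k <= (Delta j k)%:R, eps j k <= alpha,
        eps j k >= alpha + (Delta j k)%:R - 1 & eps j k >= 0];
  milp_o : forall (l : 'I_H) (j k : nat), (0 < j <= k.+1)%N -> (k < N)%N ->
    [/\ o l j k <= eps j k, o l j k <= (u l)%:R,
        o l j k >= eps j k + (u l)%:R - 1 & o l j k >= 0];
  milp_tau : forall (l : 'I_H) (j k : nat), (0 < j <= k.+1)%N -> (k < N)%N ->
    [/\ tau l j k <= (Delta j k)%:R, tau l j k <= (u l)%:R,
        tau l j k >= (Delta j k)%:R + (u l)%:R - 1 & tau l j k >= 0]
}.

Definition milp_feasible (R : realType) (H d N : nat) (P : 'I_H -> R)
    (xi : 'I_N -> 'rV[R]_d) (delta : R) (u : 'I_H -> bool) (alpha : R) : Prop :=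
  exists Delta eps tau o, @milp R H d N P xi delta u alpha Delta eps tau o.

(* Main.v *)
Require Import Defs.
From mathcomp Require Import all_boot all_order all_algebra.
From mathcomp Require Import all_classical all_reals all_analysis.
From mathcomp Require Import measurable_realfun lra ring.
Set Implicit Arguments.
Unset Strict Implicit.
Unset Printing Implicit Defensive.
Import Order.TTheory GRing.Theory Num.Theory.
Import numFieldNormedType.Exports.
Local Open Scope classical_set_scope.
Local Open Scope ring_scope.

(** Write L for the scheduled load, s_1 >= ... >= s_N for the sorted sample
    totals, and call a point unsafe when its total exceeds L.  As the dual norm
    of the all-ones vector is 1, making a sample with total t unsafe costs its
    shortfall max(L - t, 0), as an infimum that need not be attained.  With
    budget delta the most harmful perturbation of the empirical law spends it on
    the samples of largest total first.  Hence, for alpha < 1, the chance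
    constraint says that pushing the alpha N largest samples out of the safe
    region, the last one fractionally, costs at least delta on average:

      delta <= 1/N (sum_(i <= k) max(L - s_i, 0)
                    + (alpha N - k) max(L - s_(k+1), 0)),  k <= alpha N <= k+1.

    If j is the first rank with s_j <= L, the positive parts vanish below j and
    can be dropped from j on, and the right-hand side becomes the expression
    [guarantee j k] that the Wasserstein row of the program evaluates at the
    selected pair (j, k).  So the program asks for a pair (j, k) with
    delta <= guarantee j k, subject to rows that make j and k the right ranks
    ([milp_feasibleP]).

    A certificate implies the chance constraint by weak duality.  Put
    s = s_(k+1) and c = L - s.  Moving mass from total t2 to an unsafe total t1
    satisfies c <= |t1 - t2| + ramp(t2), where ramp(t) = min(c, max(t - s, 0)).
    Integrating this against a coupling bounds c times the unsafe probability by
    the transport cost plus the empirical mean of the ramp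
    ([ambiguity_exceed_bound]), and the certificate says precisely that this
    bound is at most c alpha.

    Conversely, if the cost above is smaller than delta, there is room to move a
    little more than the alpha N largest samples slightly beyond the threshold
    L, along a direction that almost attains the dual norm.  The resulting
    finitely supported law stays in the ambiguity set and is unsafe with
    probability more than alpha ([chance_constraint_shortfall],
    [critical_shortfall]).  At alpha = 1 the chance constraint holds for every
    law while the program still asks for a cost of delta, so this direction is
    restricted to alpha < 1. *)

(** * Finitely supported laws and integrals of arbitrary functions *)

Lemma finite_support_measure (disp : measure_display)
    (T : measurableType disp) (R : realType) (I : Type) (r : seq I)
    (w : I -> R) (a : I -> T) (w0 : forall i, 0 <= w i) :
  exists m : {measure set T -> \bar R},
    (forall A, m A = \sum_(i <- r) (w i)%:E * \d_(a i) A)%E /\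
    (forall f : T -> \bar R, measurable_fun setT f -> (forall x, 0 <= f x)%E ->
       \int[m]_x f x = \sum_(i <- r) (w i)%:E * f (a i))%E.
Proof.
elim: r => [|i r [m [mE mI]]].
  exists mzero; split=> [A|f mf f0]; rewrite big_nil//.
  exact: integral_measure_zero.
exists (measure_add (mscale (NngNum (w0 i)) \d_(a i)) m); split=> [A|f mf f0].
  by rewrite big_cons -mE -[LHS]/(measure_add _ _ A) measure_addE.
rewrite ge0_integral_measure_add// big_cons mI// ge0_integral_mscale//.
by rewrite integral_dirac// diracT mul1e.
Qed.

Section ArbitraryIntegrands.
Import HBNNSimple.

(** The integral of a nonnegative function is a supremum over simple minorants,
    so an upper bound does not require the function to be measurable.  The
    transport cost of a norm is bounded this way, which avoids comparing the
    product sigma-algebra with the Borel sets of the product. *)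
Lemma integral_le_minorants (disp : measure_display) (T : measurableType disp) (R : realType)
    (m : {measure set T -> \bar R}) (f : T -> \bar R) (c : \bar R) :
  (forall x, 0 <= f x)%E ->
  (forall h : T -> R, measurable_fun setT h -> (forall x, 0 <= (h x)%:E <= f x)%E ->
     \int[m]_x (h x)%:E <= c)%E ->
  (\int[m]_x f x <= c)%E.
Proof.
move=> f0 hc; rewrite ge0_integralTE//.
apply: ge_ereal_sup => _ [h /= hf <-].
rewrite -integralT_nnsfun; apply: hc => // x.
by rewrite lee_fin fun_ge0 hf.
Qed.

(** Monotonicity holds for arbitrary nonnegative functions, again because only
    simple minorants enter the definition of the integral. *)
Lemma ge0_le_integralT (disp : measure_display) (T : measurableType disp) (R : realType)
    (m : {measure set T -> \bar R}) (f g : T -> \bar R) :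
  (forall x, 0 <= f x <= g x)%E ->
  (\int[m]_x f x <= \int[m]_x g x)%E.
Proof.
move=> fg.
have f0 x : (0 <= f x)%E by have /andP[] := fg x.
have g0 x : (0 <= g x)%E by have /andP[/le_trans] := fg x; apply.
rewrite !ge0_integralTE//; apply: ereal_sup_le => _ [h /= hf <-]; exists h => //= x.
by apply: le_trans (hf x) _; have /andP[] := fg x.
Qed.

End ArbitraryIntegrands.

(** Packs a measure of mass one as a probability: normalizing it leaves it
    unchanged. *)
Lemma measure_probability (disp : measure_display) (T : measurableType disp) (R : realType)
    (m : {measure set T -> \bar R}) :
  m setT = 1%E -> exists Q : probability T R, forall A, Q A = m A.
Proof.
move=> m1.
exists (mnormalize m \d_point) => A.
by rewrite /= /mnormalize m1/= onee_eq0/= invr1 mule1.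
Qed.

(** * The total output of a vector *)

Section Total.
Context (R : realType) (d : nat).

Lemma total_outputD : {morph @total_output R d : x y / x + y}.
Proof. by move=> x y; rewrite -big_split; apply: eq_bigr => i _; rewrite mxE. Qed.

Lemma total_outputZ a (x : 'rV[R]_d) : total_output (a *: x) = a * total_output x.
Proof. by rewrite mulr_sumr; apply: eq_bigr => i _; rewrite mxE. Qed.

Lemma total_outputB : {morph @total_output R d : x y / x - y}.
Proof. by move=> x y; rewrite total_outputD -scaleN1r total_outputZ mulN1r. Qed.

Lemma total_output_continuous : continuous (@total_output R d : 'rV[R]_d -> R).
Proof.
move=> x; rewrite /total_output.
have FF : Filter (nbhs x) by exact: nbhs_filter.
apply: cvg_big => [|i _]; [exact: add_continuous | exact: coord_continuous].
Qed.

Lemma measurable_total_output :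
  measurable_fun setT (@total_output R d : borel_rV R d -> R).
Proof.
apply: (measurability _ (RGenOpens.measurableE R)).
move=> _ [_ [a [b ->] <-]]; rewrite setTI; apply: sub_sigma_algebra.
move/continuousP: total_output_continuous; apply.
exact: interval_open.
Qed.
End Total.

Section Norm.
Context (R : realType) (d : nat) (nrm : 'rV[R]_d -> R) (hnrm : is_norm nrm).

Lemma is_norm0 : nrm 0 = 0.
Proof. by have [_ nZ _] := hnrm; rewrite -(scale0r 0) nZ normr0 mul0r. Qed.

Lemma is_normN x : nrm (- x) = nrm x.
Proof. by have [_ nZ _] := hnrm; rewrite -scaleN1r nZ normrN1 mul1r. Qed.

Lemma is_norm_ge0 x : 0 <= nrm x.
Proof.
have [nD _ _] := hnrm; have := nD x (- x).
by rewrite subrr is_norm0 is_normN; lra.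
Qed.

Hypothesis hdual : dual_norm nrm (const_mx 1) = 1.

Let totals := [set total_output x | x in [set x | nrm x <= 1]].

Lemma sup_total_unit_ball : sup totals = 1.
Proof.
rewrite -hdual /dual_norm; congr (sup _); apply/seteqP.
by split=> _ [x /= nx <-]; exists x => //; apply: eq_bigr => i _;
  rewrite mxE mul1r.
Qed.

(** The supremum of a set without least upper bound is 0 by convention, so the
    value 1 proves that the unit ball has bounded totals. *)
Lemma has_sup_total_unit_ball : has_sup totals.
Proof.
apply: contrapT => /sup_out; rewrite sup_total_unit_ball => /eqP.
by rewrite oner_eq0.
Qed.

Lemma total_le_norm x : `|total_output x| <= nrm x.
Proof.
have [_ nZ n0] := hnrm.
suff le_t y : total_output y <= nrm y.
  rewrite ler_norml le_t andbT lerNl -is_normN -[- total_output x]mulN1r.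
  by rewrite -total_outputZ scaleN1r le_t.
have [y0|y0] := eqVneq (nrm y) 0.
  by rewrite (n0 _ y0) is_norm0 /total_output big1// => i _; rewrite mxE.
have ypos : 0 < nrm y by rewrite lt_def y0 is_norm_ge0.
suff : total_output ((nrm y)^-1 *: y) <= 1.
  by rewrite total_outputZ mulrC ler_pdivrMr// mul1r.
rewrite -sup_total_unit_ball; apply: ub_le_sup.
  by case: has_sup_total_unit_ball.
by exists ((nrm y)^-1 *: y) => //=; rewrite nZ normfV ger0_norm ?mulVf// ltW.
Qed.

Lemma near_optimal_direction (e : R) : 0 < e ->
  exists v, nrm v <= 1 /\ 1 - e < total_output v.
Proof.
move=> e0; have [_ [v /= nv <-]] := sup_adherent e0 has_sup_total_unit_ball.
by rewrite sup_total_unit_ball; exists v.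
Qed.

End Norm.

(** * Samples sorted by total *)

Section Samples.
Context (R : realType) (H d N : nat) (P : 'I_H -> R) (xi : 'I_N -> 'rV[R]_d).
Local Notation T := (borel_rV R d).

(** Replaces the samples by a sequence [x] in non-increasing order of totals.
    Ranks are counted from 0 in [x] and from 1 in [sorted_total]. *)
Lemma sorted_samples : exists x : nat -> 'rV[R]_d,
  [/\ forall i, (i < N)%N -> sorted_total P xi i.+1 = total_output (x i),
      forall i j, (i <= j < N)%N -> total_output (x j) <= total_output (x i)
    & forall A, @empirical R d N xi A =
        (\sum_(i <- iota 0 N) (N%:R^-1)%:E * \d_(x i : T) A)%E].
Proof.
set s := sort (relpre (@total_output R d) (fun x y : R => y <= x))
  [seq xi n | n <- enum 'I_N].
have szs : size s = N by rewrite size_sort size_map size_enum_ord.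
have stE i : (i < N)%N -> sorted_total P xi i.+1 = total_output (nth 0 s i).
  by move=> iN; rewrite /= map_comp sort_map (nth_map 0)// szs.
exists (nth 0 s); split=> //.
- move=> i j /andP[ij jN].
  apply: (@sorted_leq_nth _ (relpre (@total_output R d) (fun x y : R => y <= x))).
  + by move=> x y z /= yx xz; exact: le_trans xz yx.
  + by move=> x /=.
  + by apply: sort_sorted => x y; exact: le_total.
  + by rewrite inE szs (leq_ltn_trans ij).
  + by rewrite inE szs.
  + by [].
- move=> A; rewrite /empirical ge0_sume_distrr//.
  have -> : iota 0 N = index_iota 0 (size s) by rewrite szs /index_iota subn0.
  rewrite -(big_nth 0 xpredT (fun y : T => (N%:R^-1)%:E * \d_y A)%E).
  rewrite (perm_big _ (permEl (perm_sort _ _)))/= big_map big_enum.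
  by apply: eq_bigr.
Qed.

End Samples.

(** * Weak duality for the unsafe probability *)

(** The dual potential of the transport problem: with L - s the price of an
    unsafe unit of mass, [ramp L s t] is what remains of this price after paying
    for the transport of a sample of total [t] beyond [L]. *)
Definition ramp {R : realType} (L s t : R) := Num.min (L - s) (Num.max (t - s) 0).

Lemma ramp_ge0 {R : realType} (L s t : R) : s <= L -> 0 <= ramp L s t.
Proof. by rewrite /ramp le_min le_max lexx orbT andbT subr_ge0. Qed.

(** Dual feasibility of the pair made of the unsafe indicator, weighted by
    L - s, and the ramp. *)
Lemma ramp_transport {R : realType} (L s t1 t2 : R) :
  s <= L -> L < t1 -> L - s <= `|t1 - t2| + ramp L s t2.
Proof.
move=> sL Lt; rewrite /ramp.
have := ler_norm (t1 - t2); have := normr_ge0 (t1 - t2).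
case: (leP (t2 - s) 0) => h1; first by case: (leP (L - s) 0) => h2; lra.
by case: (leP (L - s) (t2 - s)) => h2; lra.
Qed.

Lemma measurable_ramp {R : realType} (L s : R) : measurable_fun setT (ramp L s).
Proof.
apply: measurable_minr; first exact: measurable_cst.
apply: measurable_maxr; last exact: measurable_cst.
by apply: measurable_funB; [exact: measurable_id | exact: measurable_cst].
Qed.

Section Duality.
Context (R : realType) (d N : nat) (nrm : 'rV[R]_d -> R).
Hypothesis total_le : forall x, `|total_output x| <= nrm x.
Context (xi : 'I_N -> 'rV[R]_d) (x : nat -> 'rV[R]_d).
Local Notation T := (borel_rV R d).
Hypothesis empE : forall A, @empirical R d N xi A =
        (\sum_(i <- iota 0 N) (N%:R^-1)%:E * \d_(x i : T) A)%E.

Lemma measurable_exceed (L : R) : measurable [set y : T | L < total_output y].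
Proof.
have := @measurable_total_output R d measurableT _ (measurable_itv `]L, +oo[).
rewrite setTI; congr measurable; apply/seteqP.
by split=> y /=; rewrite in_itv/= andbT.
Qed.

(** The second marginal is known on measurable sets only, which suffices to
    replace it by a weighted sum of Dirac masses under the integral. *)
Lemma integral_snd_coupling (f : probability T R) (Q : probability (T * T)%type R)
    (g : T -> \bar R) :
  couplings f (empirical xi) Q -> measurable_fun setT g -> (forall y, 0 <= g y)%E ->
  (\int[Q]_z g z.2 = \sum_(i <- iota 0 N) (N%:R^-1)%:E * g (x i))%E.
Proof.
move=> [_ Q2] mg g0.
have w0 (i : nat) : 0 <= N%:R^-1 :> R by rewrite invr_ge0.
have [m [mE mI]] := @finite_support_measure _ T R nat (iota 0 N) _ (x : nat -> T) w0.
rewrite -mI//.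
rewrite -[LHS](@ge0_integral_pushforward _ _ _ _ _ snd _ Q setT g)//.
by apply: eq_measure_integral => A mA _; rewrite mE -empE; exact: Q2.
Qed.

(** Integrates [ramp_transport] against the coupling.  The transport cost is
    first bounded below by the difference of totals, which is measurable. *)
Lemma weak_duality (f : probability T R) (Q : probability (T * T)%type R) (L s : R) :
  s <= L -> couplings f (empirical xi) Q ->
  ((L - s)%:E * f [set y : T | (L < total_output y)%R] <=
     \int[Q]_z (nrm ((z.1 : 'rV[R]_d) - (z.2 : 'rV[R]_d)))%:E +
     (N%:R^-1 * \sum_(i <- iota 0 N) ramp L s (total_output (x i)))%:E)%E.
Proof.
move=> sL cQ; set V := [set y : T | _].
have mV : measurable V by exact: measurable_exceed.
have c0 : 0 <= L - s by rewrite subr_ge0.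
have mt := @measurable_total_output R d.
have mt1 : measurable_fun setT (fun z : T * T => total_output z.1).
  by apply: (measurableT_comp mt).
have mt2 : measurable_fun setT (fun z : T * T => total_output z.2).
  by apply: (measurableT_comp mt).
have mramp : measurable_fun setT (fun y : T => (ramp L s (total_output y))%:E).
  by apply/measurable_EFinP; apply: (measurableT_comp (measurable_ramp L s) mt).
have mdiff : measurable_fun setT
    (fun z : T * T => (`|total_output z.1 - total_output z.2|)%:E).
  apply/measurable_EFinP; apply: measurableT_comp => //.
  exact: measurable_funB.
have mVQ : measurable (fst @^-1` V : set (T * T)).
  by rewrite -[X in measurable X]setTI; apply: measurable_fst.
pose A := (\int[Q]_z (`|total_output (z.1 : 'rV[R]_d) - total_output (z.2 : 'rV[R]_d)|%R)%:E)%E.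
pose B := (\int[Q]_z (ramp L s (total_output (z.2 : 'rV[R]_d)))%:E)%E.
have -> : f V = Q (fst @^-1` V) by rewrite cQ.1.
apply: (@le_trans _ _ (A + B)%E); last first.
  apply: leeD.
    apply: ge0_le_integralT => z; rewrite !lee_fin normr_ge0/=.
    apply: le_trans (total_le _).
    by rewrite total_outputB.
  rewrite /B (@integral_snd_coupling f Q (fun y => (ramp L s (total_output y))%:E))//.
    by rewrite mulr_sumr -sumEFin.
  by move=> y; rewrite lee_fin ramp_ge0.
rewrite /A /B -ge0_integralD//=; last 2 first.
- by move=> z _; rewrite lee_fin ramp_ge0.
- by apply: (measurableT_comp mramp).
rewrite -[fst @^-1` V]setIT -integral_indic//.
rewrite -ge0_integralZl_EFin//; last first.
  by apply/measurable_EFinP; exact: measurable_indic.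
apply: ge0_le_integralT => z; apply/andP; split.
  by rewrite -EFinM lee_fin mulr_ge0.
rewrite -EFinM -EFinD lee_fin indicE.
have r0 := @ramp_ge0 _ L s (total_output z.2) sL.
case: (boolP (z \in _)) => [|_]; last first.
  by rewrite mulr0 addr_ge0.
rewrite inE /V /= mulr1 => Lt.
exact: ramp_transport.
Qed.

Lemma ambiguity_exceed_bound (delta L s : R) (f : probability T R) :
  s <= L -> ambiguity_set nrm xi delta f ->
  ((L - s)%:E * f [set y : T | (L < total_output y)%R] <=
     (delta + N%:R^-1 * \sum_(i <- iota 0 N) ramp L s (total_output (x i)))%:E)%E.
Proof.
move=> sL; rewrite /ambiguity_set /= => fD.
rewrite [leRHS]EFinD -leeBlDr//; apply: le_trans fD.
apply: le_ereal_inf_tmp => _ [Q cQ <-].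
by rewrite leeBlDr//; exact: weak_duality.
Qed.

End Duality.

(** * Perturbing the empirical law *)

Section Transport.
Context (R : realType) (d N : nat) (nrm : 'rV[R]_d -> R).
Hypothesis N_gt0 : (0 < N)%N.
Hypothesis nrm_ge0 : forall x, 0 <= nrm x.
Hypothesis nrm0 : nrm 0 = 0.
Context (xi : 'I_N -> 'rV[R]_d) (x : nat -> 'rV[R]_d).
Local Notation T := (borel_rV R d).
Hypothesis empE : forall A, @empirical R d N xi A =
        (\sum_(i <- iota 0 N) (N%:R^-1)%:E * \d_(x i : T) A)%E.

(** Moves the fraction [theta i] of sample [i] to [y i]: the coupling has the
    two atoms (y i, x i) and (x i, x i), with masses theta i / N and
    (1 - theta i) / N, and the perturbed law is its first marginal. *)
Lemma partial_transport (theta : nat -> R) (y : nat -> 'rV[R]_d) (delta : R) :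
  (forall i, 0 <= theta i <= 1) ->
  N%:R^-1 * \sum_(i <- iota 0 N) theta i * nrm (y i - x i) <= delta ->
  exists f : probability T R, ambiguity_set nrm xi delta f /\
    forall A : set T, measurable A -> (forall i, A (y i)) ->
      ((N%:R^-1 * \sum_(i <- iota 0 N) theta i)%:E <= f A)%E.
Proof.
move=> theta01 cost.
have Ni0 : 0 <= N%:R^-1 :> R by rewrite invr_ge0.
pose r := [seq (i, true) | i <- iota 0 N] ++ [seq (i, false) | i <- iota 0 N].
pose w (ib : nat * bool) : R :=
  N%:R^-1 * (if ib.2 then theta ib.1 else 1 - theta ib.1).
pose a (ib : nat * bool) : T * T :=
  (if ib.2 then y ib.1 else x ib.1, x ib.1).
have w0 ib : 0 <= w ib.
  rewrite /w mulr_ge0//; have /andP[t0 t1] := theta01 ib.1.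
  by case: ifP => // _; rewrite subr_ge0.
have [m [mE mI]] := @finite_support_measure _ (T * T)%type R _ r w a w0.
have [mu [muE _]] := @finite_support_measure _ T R _ r w (fst \o a) w0.
have w1 : \sum_(ib <- r) w ib = 1.
  rewrite /r big_cat !big_map /w/= -big_split/=.
  under eq_bigr do rewrite -mulrDr subrKC mulr1.
  rewrite big_const_seq count_predT size_iota iter_addr addr0 -[LHS]mulr_natr.
  by rewrite mulVf// pnatr_eq0 -lt0n.
have [|Q QE] := @measure_probability _ _ _ m.
  by rewrite mE -w1 -sumEFin; apply: eq_bigr => ib _; rewrite diracT mule1.
have [|f fE] := @measure_probability _ _ _ mu.
  by rewrite muE -w1 -sumEFin; apply: eq_bigr => ib _; rewrite diracT mule1.
have cQ : couplings f (empirical xi) Q.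
  split=> A mA; rewrite QE mE ?fE ?muE; first by [].
  rewrite empE /r big_cat !big_map /w/= -big_split/=.
  apply: eq_bigr => i _; rewrite /a/= !diracE/= -!EFinM -EFinD; congr (_%:E).
  have -> : ((y i : T, x i : T) \in snd @^-1` A) = (x i \in A) by [].
  have -> : ((x i : T, x i : T) \in snd @^-1` A) = (x i \in A) by [].
  by rewrite -mulrDl -mulrDr subrKC mulr1.
exists f; split.
  rewrite /ambiguity_set/=; apply: ge_ereal_inf; eexists; first by exists Q.
  apply: integral_le_minorants => [z|h mh h0]; first by rewrite lee_fin nrm_ge0.
  rewrite (eq_measure_integral m) => [|A _ _]; last exact: QE.
  rewrite mI; last 2 first.
  - exact/measurable_EFinP.
  - by move=> z; have /andP[] := h0 z.
  apply: (@le_trans _ _ (\sum_(ib <- r) (w ib * nrm ((a ib).1 - (a ib).2))%:E)%E).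
    apply: lee_sum => ib _; rewrite -EFinM lee_fin ler_wpM2l//.
    by have /andP[_] := h0 (a ib); rewrite lee_fin.
  rewrite sumEFin lee_fin /r big_cat !big_map /w /a/=.
  rewrite [X in _ + X]big1 ?addr0 => [|i _]; last by rewrite subrr nrm0 mulr0.
  apply: le_trans cost; rewrite mulr_sumr.
  by under eq_bigr do rewrite -mulrA.
move=> A mA yA; rewrite fE muE /r big_cat !big_map /w /a/=.
apply: (@le_trans _ _ (\sum_(i <- iota 0 N) (N%:R^-1 * theta i)%:E * \d_(y i : T) A)%E).
  rewrite mulr_sumr -sumEFin; apply: lee_sum => i _.
  by rewrite diracE mem_set// mule1.
rewrite leeDl//; apply: sume_ge0 => i _.
by rewrite mule_ge0// lee_fin (w0 (i, false)).
Qed.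

End Transport.

(** * Bounds for the chance constraint *)

(** Only the first k + 1 samples take part in a worst-case perturbation, and the
    last of them partially. *)
Lemma sum_iota_fractional {R : realType} (N k : nat) (q : R) (g : nat -> R) :
  (k < N)%N ->
  \sum_(i <- iota 0 N) (if (i < k)%N then 1 else if i == k then q else 0) * g i
    = \sum_(i <- iota 0 k) g i + q * g k.
Proof.
move=> kN; have -> : N = (k + (N - k.+1).+1)%N by rewrite subnSK// subnKC// ltnW.
rewrite iotaD big_cat/= add0n big_cons ltnn eqxx; congr (_ + _).
  by apply: eq_big_seq => i; rewrite mem_iota add0n => /= ->; rewrite mul1r.
rewrite big_seq big1 ?addr0// => i; rewrite mem_iota => /andP[ki _].
by rewrite ltnNge (ltnW ki) gtn_eqF//= mul0r.
Qed.

(** The least transport cost that brings a sample to the threshold [L]. *)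
Definition shortfall {R : realType} {d : nat} (L : R) (y : 'rV[R]_d) : R :=
  Num.max (L - total_output y) 0.

Section ChanceConstraint.
Context (R : realType) (H d N : nat) (P : 'I_H -> R) (nrm : 'rV[R]_d -> R).
Hypothesis hnrm : is_norm nrm.
Hypothesis hdual : dual_norm nrm (const_mx 1) = 1.
Hypothesis N_gt0 : (0 < N)%N.
Context (xi : 'I_N -> 'rV[R]_d) (x : nat -> 'rV[R]_d).
Local Notation T := (borel_rV R d).
Hypothesis empE : forall A, @empirical R d N xi A =
        (\sum_(i <- iota 0 N) (N%:R^-1)%:E * \d_(x i : T) A)%E.
Context (delta : R) (u : 'I_H -> bool) (alpha : R).
Hypothesis delta_gt0 : 0 < delta.
Local Notation L := (load P u).

Lemma prob_safe (f : probability T R) :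
  (f [set y : T | (0 <= L - total_output y)%R] =
   1 - f [set y : T | (L < total_output y)%R])%E.
Proof.
rewrite -probability_setC; last exact: measurable_exceed.
congr (f _); apply/seteqP.
by split=> y /=; rewrite subr_ge0 leNgt => /negP.
Qed.

(** The dual bound forces the unsafe probability of every law of the ambiguity
    set below alpha as soon as its right-hand side is at most (L - s) alpha. *)
Lemma certificate_sufficient (s : R) :
  s < L ->
  delta + N%:R^-1 * \sum_(i <- iota 0 N) ramp L s (total_output (x i))
    <= (L - s) * alpha ->
  dr_chance_constraint P nrm xi delta u alpha.
Proof.
move=> sL cert; apply: le_ereal_inf_tmp => _ [f fD <-].
rewrite prob_safe EFinB leeB//.
have c0 : 0 < L - s by rewrite subr_gt0.
rewrite -(@lee_pmul2l _ (L - s)%:E)// ?lte_fin//.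
rewrite -EFinM; apply: (le_trans (ambiguity_exceed_bound _ empE (ltW sL) fD)).
  exact: total_le_norm.
by rewrite lee_fin.
Qed.

(** If moving [k] samples and the fraction [q] of the next one cost less than
    delta, the surplus [delta - D] would pay for two corrections: pushing each
    sample by [eta] strictly beyond [L], and using a direction of total only
    1 - eta per unit of norm.  The perturbed law would be unsafe with probability
    at least (k + q) / N > alpha. *)
Lemma chance_constraint_shortfall (k : nat) (q : R) :
  (k < N)%N -> 0 <= q <= 1 -> alpha < (k%:R + q) / N%:R ->
  dr_chance_constraint P nrm xi delta u alpha ->
  delta <= N%:R^-1 * (\sum_(i <- iota 0 k) shortfall L (x i) + q * shortfall L (x k)).
Proof.
move=> kN /andP[q0 q1] aq drcc; rewrite leNgt; apply/negP.
set D := N%:R^-1 * _ => D_lt.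
have N0 : 0 < N%:R :> R by rewrite ltr0n.
have Ni0 : 0 <= N%:R^-1 :> R by rewrite invr_ge0.
have sf0 i : 0 <= shortfall L (x i) by rewrite le_max lexx orbT.
have D0 : 0 <= D.
  apply: mulr_ge0 => //.
  by apply: addr_ge0; [exact: sumr_ge0 | exact: mulr_ge0].
(* The cost is at most (D + eta) / (1 - eta), and this choice makes it delta. *)
pose eta := (delta - D) / (1 + delta).
have eta0 : 0 < eta by rewrite divr_gt0 ?subr_gt0// addr_gt0.
have etaE : eta * (1 + delta) = delta - D.
  by rewrite /eta divfK// gt_eqF// addr_gt0.
have eta1 : eta < 1 by rewrite ltr_pdivrMr ?addr_gt0//; lra.
have [v [nv tv]] := near_optimal_direction hdual eta0.
have tv0 : 0 < total_output v by lra.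
pose step i := (shortfall L (x i) + eta) / total_output v.
have step0 i : 0 <= step i.
  by apply: divr_ge0; rewrite ltW// ltr_wpDl.
pose theta i : R := if (i < k)%N then 1 else if i == k then q else 0.
have theta01 i : 0 <= theta i <= 1.
  rewrite /theta; case: ifP => _; first by rewrite ler01 lexx.
  by case: ifP => _; rewrite ?q0 ?q1// lexx ler01.
pose y i := x i + step i *: v.
have yL i : L < total_output (y i).
  rewrite total_outputD total_outputZ divfK ?gt_eqF//.
  have : L - total_output (x i) <= shortfall L (x i) by rewrite le_max lexx.
  by lra.
have cost : N%:R^-1 * \sum_(i <- iota 0 N) theta i * nrm (y i - x i) <= delta.
  apply: (@le_trans _ _ (N%:R^-1 * \sum_(i <- iota 0 N) theta i * step i)).
    rewrite ler_wpM2l//; apply: ler_sum => i _.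
    have [_ nZ _] := hnrm; have /andP[t0 _] := theta01 i.
    rewrite ler_wpM2l// /y addrC addKr nZ ger0_norm//.
    by rewrite ler_piMr.
  rewrite sum_iota_fractional// /step -mulr_suml mulrA -mulrDl mulrA.
  rewrite ler_pdivrMr//.
  apply: (@le_trans _ _ (D + eta)).
    rewrite big_split/= [q * (_ + _)]mulrDr addrACA mulrDr lerD2l.
    rewrite big_const_seq count_predT size_iota iter_addr addr0.
    rewrite mulrC ler_pdivrMr// mulrC -[eta *+ k]mulr_natr -mulrDr ler_wpM2l//.
      exact: ltW.
    apply: (@le_trans _ _ k.+1%:R); last by rewrite ler_nat.
    by rewrite -natr1 lerD2l.
  have : delta * (1 - eta) <= delta * total_output v.
    by rewrite ler_wpM2l// ltW.
  by lra.
have [f [fD fV]] := partial_transport N_gt0 (is_norm_ge0 hnrm) (is_norm0 hnrm)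
  empE theta01 cost.
have := fV _ (measurable_exceed L) yL.
have -> : \sum_(i <- iota 0 N) theta i = k%:R + q.
  have := sum_iota_fractional q (fun=> 1) kN; rewrite mulr1.
  under eq_bigr do rewrite mulr1.
  by rewrite big_const_seq count_predT size_iota iter_addr addr0 -/theta => ->.
have : ((1 - alpha)%:E <= 1 - f [set y : T | (L < total_output y)%R])%E.
  apply: le_trans drcc _; rewrite -prob_safe.
  by apply: ge_ereal_inf; eexists; [exists f|].
move: (f _) => [r| |] //; rewrite ?lee_fin => h1 h2; move: aq; rewrite mulrC; lra.
Qed.

End ChanceConstraint.

(** * The program selects one pair of ranks *)

Section Selection.
Context (R : realType) (N : nat).

Definition in_range (j k : nat) := (0 < j <= k.+1)%N && (k < N)%N.

(** Reduces the aggregate rows of the program to the selected pair: their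
    summands vanish wherever the selection variable does. *)
Lemma sum_selected (j0 k0 : nat) (F : nat -> nat -> R) :
  in_range j0 k0 ->
  (forall j k, in_range j k -> (j, k) != (j0, k0) -> F j k = 0) ->
  \sum_(1 <= j < N.+1) \sum_(j.-1 <= k < N) F j k = F j0 k0.
Proof.
move=> /andP[/andP[j1 jk] kN] F0.
have zero j k : (0 < j)%N -> k \in index_iota j.-1 N ->
    (j, k) != (j0, k0) -> F j k = 0.
  rewrite mem_index_iota => j_gt0 /andP[jk' k'N]; apply: F0.
  by rewrite /in_range j_gt0 k'N -(prednK j_gt0) ltnS jk'.
have jk' : (j0.-1 <= k0)%N by rewrite -ltnS prednK.
rewrite (bigD1_seq j0)/= ?iota_uniq ?mem_index_iota ?j1 ?ltnS ?(leq_trans jk)//.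
rewrite (bigD1_seq k0)/= ?iota_uniq ?mem_index_iota ?kN ?andbT ?jk'//.
rewrite [X in _ + X + _]big_seq_cond [X in _ + X + _]big1 ?addr0; last first.
  by move=> k /andP[kr kk]; rewrite zero// xpair_eqE negb_and kk orbT.
rewrite big_seq_cond big1 ?addr0// => j /andP[].
rewrite mem_index_iota => /andP[j_gt0 _] jj.
by rewrite big_seq big1// => k kr; rewrite zero// xpair_eqE negb_and jj.
Qed.

Lemma selectionP (Delta : nat -> nat -> bool) :
  \sum_(1 <= j < N.+1) \sum_(j.-1 <= k < N) (Delta j k)%:R = 1 :> R ->
  exists j0 k0, [/\ in_range j0 k0, Delta j0 k0
    & forall j k, in_range j k -> (j, k) != (j0, k0) -> Delta j k = false].
Proof.
under eq_bigr do rewrite -natr_sum.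
rewrite -natr_sum => /eqP; rewrite pnatr_eq1 => /eqP.
move=> /sum_nat_seq_eq1[j0 [j0r _ j0E j0U]].
have [k0 [k0r _ k0E k0U]] := sum_nat_seq_eq1 j0E.
move: j0r k0r; rewrite !mem_index_iota ltnS => /andP[j1 jN] /andP[jk kN].
exists j0, k0; split.
- by rewrite /in_range j1 kN -(prednK j1) ltnS jk.
- by move: k0E; case: (Delta j0 k0).
move=> j k /andP[/andP[j_gt0 jk'] kN'].
have kr : k \in index_iota j.-1 N.
  by rewrite mem_index_iota kN' andbT -ltnS prednK.
rewrite xpair_eqE negb_and; have [jj|jj _] := eqVneq j j0.
  move=> /= kk; rewrite jj in kr *; have := k0U _ kk kr isT.
  by case: (Delta j0 k).
have := j0U _ jj; rewrite mem_index_iota j_gt0 ltnS.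
rewrite (leq_trans jk' kN') => /(_ isT isT) /eqP.
rewrite sum_nat_seq_eq0 => /allP/(_ _ kr)/=.
by case: (Delta j k).
Qed.

End Selection.

Section Milp.
Context (R : realType) (H d N : nat) (P : 'I_H -> R) (xi : 'I_N -> 'rV[R]_d).
Context (delta : R) (u : 'I_H -> bool) (alpha : R).
Hypothesis alpha01 : 0 <= alpha <= 1.
Local Notation S := (sorted_total P xi).
Local Notation L := (load P u).

(** The average cost of making the alpha N largest samples unsafe, when the
    first rank at or below the load is [j] and [k] is the integer part of
    alpha N; see [chance_constraint_certificate]. *)
Definition guarantee (j k : nat) : R :=
  N%:R^-1 * \sum_(j <= i < k.+1) (S k.+1 - S i)
  + (L - S k.+1) * (alpha - j.-1%:R / N%:R).

Definition certificate (j k : nat) : Prop :=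
  [/\ k%:R <= alpha * N%:R <= k.+1%:R, S j <= L <= S j.-1
    & delta <= guarantee j k].

(** The McCormick rows force eps = alpha Delta, o = alpha Delta u and
    tau = Delta u when Delta and u are binary; substituting these values
    undoes the linearization. *)
Lemma linearized_guarantee (j k : nat) (b : bool) :
  - (N%:R^-1 * \sum_(j <= i < k.+1) (S k.+1 - S i) * b%:R)
  - \sum_(l < H) P l * (alpha * b%:R * (u l)%:R
                        - j.-1%:R / N%:R * (b%:R * (u l)%:R))
  + S k.+1 * (alpha * b%:R - j.-1%:R / N%:R * b%:R)
  = - guarantee j k * b%:R.
Proof.
rewrite -mulr_suml.
have -> : \sum_(l < H) P l * (alpha * b%:R * (u l)%:R
                        - j.-1%:R / N%:R * (b%:R * (u l)%:R))
  = L * ((alpha - j.-1%:R / N%:R) * b%:R).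
  by rewrite mulr_suml; apply: eq_bigr => l _; ring.
by rewrite /guarantee; ring.
Qed.

(** The rows determine every auxiliary variable from the selected pair, and the
    values so determined satisfy the McCormick rows because alpha lies in
    [0, 1]. *)
Lemma milp_feasibleP :
  milp_feasible P xi delta u alpha <->
  exists j k, in_range N j k /\ certificate j k.
Proof.
split=> [[Delta [eps [tau [ou [w1 sel risk ld he ho ht]]]]]|].
  have [j0 [k0 [r0 D0 Dother]]] := selectionP sel.
  have pick (F : nat -> nat -> R) :
      \sum_(1 <= j < N.+1) \sum_(j.-1 <= k < N) F j k * (Delta j k)%:R = F j0 k0.
    rewrite (sum_selected r0) ?D0 ?mulr1// => j k jk jk0.
    by rewrite Dother// mulr0.
  rewrite !pick in risk ld.
  have bracketE j k : in_range N j k ->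
    - (N%:R^-1 * \sum_(j <= i < k.+1) (S k.+1 - S i) * (Delta j k)%:R)
    - \sum_(l < H) P l * (ou l j k - j.-1%:R / N%:R * tau l j k)
    + S k.+1 * (eps j k - j.-1%:R / N%:R * (Delta j k)%:R)
    = - guarantee j k * (Delta j k)%:R.
    move=> /andP[jk kN]; rewrite -linearized_guarantee.
    have epsE : eps j k = alpha * (Delta j k)%:R.
      by have [] := he j k jk kN; case: (Delta j k) => /=; lra.
    rewrite -epsE; congr (_ - _ + _); apply: eq_bigr => l _; congr (_ * (_ - _ * _)).
      by have [] := ho l j k jk kN; case: (u l) => /=; lra.
    by have [] := ht l j k jk kN; case: (u l) => /=; lra.
  exists j0, k0; split=> //; split=> //; rewrite -lerN2.
  rewrite (sum_selected r0) in w1; first by rewrite bracketE// D0 mulr1 in w1.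
  by move=> j k jk jk0; rewrite bracketE// Dother// mulr0.
move=> [j0 [k0 [r0 [risk ld cert]]]].
pose Delta j k := (j == j0) && (k == k0).
have pick (F : nat -> nat -> R) :
    \sum_(1 <= j < N.+1) \sum_(j.-1 <= k < N) F j k * (Delta j k)%:R = F j0 k0.
  rewrite (sum_selected r0) /Delta ?eqxx ?mulr1// => j k _.
  by rewrite xpair_eqE => /negbTE ->; rewrite mulr0.
have /andP[a0 a1] := alpha01.
exists Delta, (fun j k => alpha * (Delta j k)%:R),
  (fun l j k => (Delta j k)%:R * (u l)%:R),
  (fun l j k => alpha * (Delta j k)%:R * (u l)%:R).
split.
- under eq_bigr do under eq_bigr do rewrite linearized_guarantee.
  by rewrite pick lerN2.
- by rewrite -[RHS](pick (fun _ _ => 1)); do 2 apply: eq_bigr => ? _; rewrite mul1r.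
- by rewrite !pick.
- by rewrite !pick.
- by move=> j k _ _; case: (Delta j k) => /=; split; lra.
- by move=> l j k _ _; case: (Delta j k); case: (u l) => /=; split; lra.
- by move=> l j k _ _; case: (Delta j k); case: (u l) => /=; split; lra.
Qed.

End Milp.

(** * Certificates and the chance constraint *)

Local Arguments sorted_total : simpl never.

Section Certificates.
Context (R : realType) (H d N : nat) (P : 'I_H -> R) (nrm : 'rV[R]_d -> R).
Hypothesis hnrm : is_norm nrm.
Hypothesis hdual : dual_norm nrm (const_mx 1) = 1.
Hypothesis N_gt0 : (0 < N)%N.
Context (xi : 'I_N -> 'rV[R]_d) (x : nat -> 'rV[R]_d).
Local Notation T := (borel_rV R d).
Local Notation S := (sorted_total P xi).
Hypothesis totalE : forall i, (i < N)%N -> S i.+1 = total_output (x i).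
Hypothesis sorted : forall i j, (i <= j < N)%N ->
  total_output (x j) <= total_output (x i).
Hypothesis empE : forall A, @empirical R d N xi A =
        (\sum_(i <- iota 0 N) (N%:R^-1)%:E * \d_(x i : T) A)%E.
Context (delta : R) (u : 'I_H -> bool) (alpha : R).
Hypothesis delta_gt0 : 0 < delta.
Hypothesis alpha_ge0 : 0 <= alpha.
Local Notation L := (load P u).

Let N0 : 0 < N%:R :> R. Proof. by rewrite ltr0n. Qed.

(** Three regimes of the ramp at s = s_(k+1): at most L - s for the ranks before
    [j], at most the distance to s for the ranks from [j] to [k], and zero after. *)
Lemma ramp_sum_le (j k : nat) :
  in_range N j k -> S k.+1 <= L ->
  \sum_(i <- iota 0 N) ramp L (S k.+1) (total_output (x i)) <=
  j.-1%:R * (L - S k.+1) + \sum_(j <= i < k.+1) (S i - S k.+1).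
Proof.
move=> /andP[/andP[j1 jk] kN]; set c := S k.+1 => cL.
have jk' : (j.-1 <= k)%N by rewrite -ltnS prednK.
have -> : iota 0 N = index_iota 0 N by rewrite /index_iota subn0.
rewrite (big_cat_nat (n := j.-1))//=; last by rewrite (leq_trans jk')// ltnW.
rewrite (big_cat_nat (n := k) (m := j.-1))//=; last exact: ltnW.
have -> : j.-1%:R * (L - c) = \sum_(0 <= i < j.-1) (L - c).
  by rewrite sumr_const_nat subn0 mulr_natl.
apply: lerD; first by apply: ler_sum => i _; rewrite ge_min lexx.
rewrite -[X in _ <= X]addr0; apply: lerD.
  rewrite -(prednK j1) big_add1/=; apply: ler_sum_nat => i /andP[ji ik].
  have iN : (i < N)%N by exact: ltn_trans kN.
  rewrite totalE// ge_min ge_max lexx/= subr_ge0.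
  by rewrite /c totalE// sorted ?orbT// (ltnW ik).
rewrite big_nat; apply: sumr_le0 => i /andP[ki iN].
by rewrite ge_min ge_max lexx andbT !subr_le0 /c totalE// sorted ?orbT// ki.
Qed.

(** With s = s_(k+1), the bound of [ramp_sum_le] turns the certificate into the
    hypothesis of [certificate_sufficient].  That s < L follows from delta > 0:
    the sum in [guarantee] is nonpositive, so the other summand, whose second
    factor is nonnegative, has to be positive. *)
Lemma certificate_chance_constraint (j k : nat) :
  in_range N j k -> certificate P xi delta u alpha j k ->
  dr_chance_constraint P nrm xi delta u alpha.
Proof.
move=> r [/andP[ka _] _ cert]; have /andP[/andP[j1 jk] kN] := r.
set c := S k.+1.
have diff_le0 : \sum_(j <= i < k.+1) (c - S i) <= 0.
  rewrite big_nat; apply: sumr_le0 => -[|i] /andP[ji ik].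
    by rewrite leqNgt j1 in ji.
  have iN : (i < N)%N by exact: ltn_trans kN.
  by rewrite subr_le0 /c !totalE// sorted// kN andbT ltnW.
have cL : c < L.
  rewrite -subr_gt0; have slack : 0 < (L - c) * (alpha - j.-1%:R / N%:R).
    have : N%:R^-1 * \sum_(j <= i < k.+1) (c - S i) <= 0.
      by rewrite mulr_ge0_le0// invr_ge0 ltW.
    by move: cert; rewrite /guarantee -/c; move: delta_gt0; lra.
  move: slack; rewrite pmulr_lgt0// lt_def.
  have -> : 0 <= alpha - j.-1%:R / N%:R.
    rewrite subr_ge0 ler_pdivrMr//; apply: le_trans ka.
    by rewrite ler_nat -ltnS prednK.
  rewrite andbT; apply: contraTneq cert => a0.
  rewrite /guarantee a0 mulr0 addr0 -ltNge; apply: le_lt_trans delta_gt0.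
  by rewrite mulr_ge0_le0// invr_ge0 ltW.
apply: (certificate_sufficient hnrm hdual empE cL).
have Ni0 : 0 <= N%:R^-1 :> R by rewrite invr_ge0 ltW.
have := ler_wpM2l Ni0 (ramp_sum_le r (ltW cL)).
have -> : \sum_(j <= i < k.+1) (S i - c) = - \sum_(j <= i < k.+1) (c - S i).
  by rewrite -sumrN; apply: eq_bigr => i _; rewrite opprB.
move: cert; rewrite /guarantee -/c.
have -> : N%:R^-1 * (j.-1%:R * (L - c) - \sum_(j <= i < k.+1) (c - S i)) =
  (L - c) * (j.-1%:R / N%:R) - N%:R^-1 * \sum_(j <= i < k.+1) (c - S i) by ring.
lra.
Qed.

(** The limit of [chance_constraint_shortfall] as the moved fraction decreases
    to alpha N - k.  The strict bound alpha N < k + 1 leaves room to approach it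
    from above. *)
Lemma critical_shortfall (k : nat) :
  (k < N)%N -> k%:R <= alpha * N%:R < k.+1%:R ->
  dr_chance_constraint P nrm xi delta u alpha ->
  delta <= N%:R^-1 * (\sum_(i <- iota 0 k) shortfall L (x i)
                      + (alpha * N%:R - k%:R) * shortfall L (x k)).
Proof.
move=> kN /andP[ka ak] drcc; rewrite leNgt; apply/negP => lt_delta.
set q0 := alpha * N%:R - k%:R in lt_delta.
have sf0 : 0 <= shortfall L (x k) by rewrite le_max lexx orbT.
rewrite ltr_pdivrMl// in lt_delta.
set A := \sum_(i <- _) _ in lt_delta.
pose g := N%:R * delta - (A + q0 * shortfall L (x k)).
have g0 : 0 < g by rewrite subr_gt0.
have sf1 : 0 < 1 + shortfall L (x k) by rewrite ltr_pwDl.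
pose kap := Num.min (1 - q0) (g / (1 + shortfall L (x k)) / 2).
have kap0 : 0 < kap.
  rewrite lt_min !divr_gt0// andbT subr_gt0 /q0 ltrBlDr.
  by rewrite addrC natr1.
have kap1 : kap <= 1 - q0 by rewrite ge_min lexx.
have kapg : kap * shortfall L (x k) < g.
  apply: (@lt_le_trans _ _ (kap * (1 + shortfall L (x k)) * 2)).
    by have := mulr_ge0 (ltW kap0) sf0; lra.
  rewrite -ler_pdivlMr// -ler_pdivlMr// ge_min orbC.
  by rewrite mulrAC lexx.
have q01 : 0 <= q0 by rewrite subr_ge0.
have q1 : 0 <= q0 + kap <= 1 by apply/andP; split; lra.
have aq : alpha < (k%:R + (q0 + kap)) / N%:R.
  by rewrite ltr_pdivlMr// /q0; lra.
have := chance_constraint_shortfall hnrm hdual N_gt0 empE delta_gt0 kN q1 aq drcc.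
by rewrite leNgt ltr_pdivrMl// -/A mulrDl => /negP; apply; rewrite /g in kapg; lra.
Qed.

(** Take [k] the integer part of alpha N; alpha < 1 gives k < N.  Since delta > 0
    some shortfall is positive, hence so is the last one, and a first rank with
    total at most L exists and does not exceed [k] when counted from 0. *)
Lemma chance_constraint_certificate :
  (forall l, 0 <= P l) -> alpha < 1 ->
  dr_chance_constraint P nrm xi delta u alpha ->
  exists j k, in_range N j k /\ certificate P xi delta u alpha j k.
Proof.
move=> P0 a1 drcc.
have aN0 : 0 <= alpha * N%:R by rewrite mulr_ge0.
pose k := Num.truncn (alpha * N%:R).
have kaN : k%:R <= alpha * N%:R < k.+1%:R by exact: truncn_itv.
have kN : (k < N)%N.
  rewrite -(ltr_nat R); case/andP: kaN => ka _; apply: le_lt_trans ka _.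
  by rewrite gtr_pMl.
have crit := critical_shortfall kN kaN drcc.
have sfE0 i : L <= total_output (x i) -> shortfall L (x i) = 0.
  by rewrite -subr_le0 => h; exact/max_idPr.
have sfE i : total_output (x i) <= L -> shortfall L (x i) = L - total_output (x i).
  by rewrite -subr_ge0 => h; exact/max_idPl.
(* Otherwise all shortfalls up to rank k vanish and delta <= 0. *)
have tkL : total_output (x k) < L.
  rewrite ltNge; apply/negP => Ltk; move: crit; rewrite leNgt => /negP; apply.
  rewrite sfE0// mulr0 addr0 big_seq big1 ?mulr0// => i.
  rewrite mem_iota add0n => /= ik; apply: sfE0; apply: le_trans Ltk _.
  by rewrite sorted// kN (ltnW ik).
have ex_below : exists i, total_output (x i) <= L by exists k; exact: ltW.
case: (ex_minnP ex_below) => j jL jmin.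
have jk : (j <= k)%N by apply: jmin; exact: ltW.
have jN : (j < N)%N by exact: leq_ltn_trans kN.
exists j.+1, k; split; first by rewrite /in_range/= ltnS jk.
split; first by case/andP: kaN => -> /ltW.
  (* Rank 0 stands for the total capacity, which bounds every load. *)
  rewrite totalE// jL/=; case: j jmin jk {jL} jN => [|j] jmin jk jN.
    by apply: ler_sum => l _; case: (u l); rewrite ?mulr1// mulr0.
  rewrite /= totalE ?(ltnW jN)// leNgt; apply/negP => /ltW/jmin.
  by rewrite ltnn.
apply: le_trans crit _; rewrite /guarantee totalE//= big_add1/=.
have -> : iota 0 k = index_iota 0 k by rewrite /index_iota subn0.
rewrite (big_cat_nat (n := j))//= big_nat big1 ?add0r => [|i /andP[_ ij]]; last first.
  apply: sfE0; rewrite leNgt; apply/negP => /ltW/jmin.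
  by rewrite leqNgt ij.
rewrite (sfE k (ltW tkL)).
under eq_big_nat => i /andP[ji ik].
  rewrite sfE; last by apply: le_trans jL; rewrite sorted// ji (ltn_trans ik).
  over.
under [X in _ <= _ * X + _]eq_big_nat => i /andP[ji ik].
  rewrite totalE; last exact: ltn_trans kN.
  over.
rewrite !sumrB !sumr_const_nat.
rewrite -[L *+ _]mulr_natl -[total_output _ *+ _]mulr_natl natrB//.
by rewrite le_eqVlt; apply/orP; left; apply/eqP; field; rewrite gt_eqF.
Qed.

End Certificates.

Theorem theorem5 (R : realType) (NHVAC NPV N : nat)
    (hHVAC : (1 <= NHVAC)%N) (hPV : (1 <= NPV)%N) (hN : (1 <= N)%N)
    (P : 'I_NHVAC -> R) (hP : forall l, 0 <= P l)
    (nrm : 'rV[R]_NPV -> R) (hnrm : is_norm nrm)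
    (hdual : dual_norm nrm (const_mx 1) = 1)
    (xi : 'I_N -> 'rV[R]_NPV) (delta : R) (hdelta : 0 < delta)
    (hsum : \sum_(l < NHVAC) P l > sorted_total P xi N)
    (u : 'I_NHVAC -> bool) (alpha : R) (halpha : 0 <= alpha <= 1) :
  (milp_feasible P xi delta u alpha ->
     dr_chance_constraint P nrm xi delta u alpha) /\
  (alpha < 1 ->
     dr_chance_constraint P nrm xi delta u alpha ->
     milp_feasible P xi delta u alpha).
Proof.
have [x [totalE sorted empE]] := sorted_samples P xi.
have alpha_ge0 : 0 <= alpha by case/andP: halpha.
split=> [/(milp_feasibleP _ _ _ _ halpha)[j [k [r cert]]]|a1 drcc].
  exact: (certificate_chance_constraint hnrm hdual hN totalE sorted empE
    hdelta r cert).
apply/milp_feasibleP => //.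
exact: (chance_constraint_certificate hnrm hdual hN totalE sorted empE
  hdelta alpha_ge0 hP a1 drcc).
Qed.
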